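(* Let $f=\sum_{|\alpha|\ge1}a_\alpha X_\alpha$ be a positive regular free holomorphic function and let $\mathcal P$ be a set of noncommutative polynomials. If $T=(T_1,\dots,T_n)\in\mathcal V^1_{f,\mathcal P}(\mathcal H)$ is such that $T\notin C_{\cdot0}$ and $T\notin C_{\cdot1}$, then there is a non-trivial joint invariant subspace under the operators $T_1,\dots,T_n$.
   Context: Let $n\in\mathbb N=\{1,2,\dots\}$. $\mathbb F_n^+$ is the unital free semigroup on generators $g_1,\dots,g_n$ with identity $g_0$; $|\alpha|$ is the word length ($|g_0|=0$). For $X=(X_1,\dots,X_n)\in B(\mathcal H)^n$ ($\mathcal H$ a complex Hilbert space) put $X_\alpha=X_{i_1}\cdots X_{i_k}$ if $\alpha=g_{i_1}\cdots g_{i_k}$ and $X_{g_0}=I$. A positive regular free holomorphic function is a formal series $f=\sum_{\alpha\in\mathbb F_n^+}a_\alpha X_\alpha$ in noncommuting variables with $\limsup_{k\to\infty}(\sum_{|\alpha|=k}|a_\alpha|^2)^{1/2k}<\infty$, $a_\alpha\ge 0$ for all $\alpha$, $a_{g_0}=0$, and $a_{g_i}>0$ for $i=1,\dots,n$. Whenever $\sum_{|\alpha|\ge1}a_\alpha X_\alpha X_\alpha^*$ converges in the weak operator topology (WOT), $\Phi_{f,X}(Y)=\sum_{|\alpha|\ge1}a_\alpha X_\alpha YX_\alpha^*$ for $Y\in B(\mathcal H)$ (WOT convergence). $\mathcal V^1_{f,\mathcal P}(\mathcal H)$ is the set of all $X\in B(\mathcal H)^n$ with $\sum_{|\alpha|\ge1}a_\alpha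 X_\alpha X_\alpha^*\le I$ and $p(X_1,\dots,X_n)=0$ for all $p\in\mathcal P$. $T\in\mathcal V^1_{f,\mathcal P}(\mathcal H)$ is of class $C_{\cdot0}$ if $\lim_{k\to\infty}\langle\Phi_{f,T}^k(I)h,h\rangle=0$ for every $h\in\mathcal H$, and of class $C_{\cdot1}$ if $\lim_{k\to\infty}\langle\Phi_{f,T}^k(I)h,h\rangle\ne0$ for every $h\in\mathcal H$, $h\ne0$. A non-trivial joint invariant subspace is a closed subspace different from $\{0\}$ and $\mathcal H$ that is invariant under each $T_i$. *)

(* Defs.v *)
(* Mathematical Components with MathComp-Analysis: the scalars are R[i], for
   an arbitrary R : realType *)
From HB Require Import structures.
From mathcomp Require Import all_boot all_order all_algebra finmap.
From mathcomp Require Import all_classical all_reals all_analysis.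
From mathcomp Require Import sesquilinear complex.
From mathcomp.analysis.showcase Require Import summability.

Set Implicit Arguments.
Unset Strict Implicit.
Unset Printing Implicit Defensive.
Import Order.TTheory GRing.Theory Num.Theory.
Import numFieldNormedType.Exports.
Local Open Scope classical_set_scope.
Local Open Scope ring_scope.
Local Open Scope complex_scope.

(* A complex Hilbert space: a Banach space over R[i] whose norm comes from an
   inner product. [inner] is linear in its first argument and conjugate linear
   in its second one. *)
HB.mixin Record isHilbert (R : realType) H of CompleteNormedModule R[i] H := {
  inner : {dot H for Num.conj};
  inner_norm : forall x : H, `|x| ^+ 2 = inner x x
}.

#[short(type="hilbertType")]
HB.structure Definition Hilbert (R : realType) :=
  { H of isHilbert R H & CompleteNormedModule R[i] H }.

(* The free semigroup F_n^+: the unit g_0 is [::] and the length is [size]. *)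
Notation word n := (seq 'I_n).

(* A noncommutative polynomial: finitely many words with their coefficients. *)
Notation ncpoly R n := {fsfun word n -> R[i] with 0}.

Section Operators.
Variables (R : realType) (H : hilbertType R).
Implicit Types A B Y Z : H -> H.

(* B(H), as a set of functions *)
Definition bounded_op : set (H -> H) :=
  [set A | linear A /\ exists M : R, forall h, `|A h| <= M%:C * `|h|].

(* On bounded_op the adjoint exists and is unique (Riesz), so that the default
   value 0 plays no role. *)
Definition adjoint A : H -> H :=
  xget 0 [set B | bounded_op B /\ forall h k, inner (A h) k = inner h (B k)].

Definition op_le A B : Prop := forall h, inner (A h) h <= inner (B h) h.

Section Tuples.
Variable n : nat.
Implicit Type X : 'I_n -> H -> H.

Definition word_op X (w : word n) : H -> H :=
  foldr (fun i A => X i \o A) idfun w.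

Definition ncpoly_eval (p : ncpoly R n) X : H -> H :=
  fun h => \sum_(w <- finsupp p) p w *: word_op X w h.

(* Z is the sum of the S w, |w| >= 1, in the weak operator topology: the net of
   sums over finite sets of words converges weakly to Z in B(H). The type R[i]^o
   is R[i] with its usual topology. *)
Definition wot_sum (S : word n -> H -> H) Z : Prop :=
  bounded_op Z /\
  forall h k,
    (fun W : {fset word n} =>
       \sum_(w <- W | (1 <= size w)%N) inner (S w h) k : R[i]^o) @ totally
    --> (inner (Z h) k : R[i]^o).

Definition Phi_term (a : word n -> R) X Y (w : word n) : H -> H :=
  fun h => (a w)%:C *: word_op X w (Y (adjoint (word_op X w) h)).

(* The default value 0 is used only when the series diverges. *)
Definition Phi (a : word n -> R) X Y : H -> H :=
  xget 0 [set Z | wot_sum (Phi_term a X Y) Z].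

Definition variety (a : word n -> R) (P : set (ncpoly R n)) :
    set ('I_n -> H -> H) :=
  [set X | [/\ forall i, bounded_op (X i),
               exists2 Z, wot_sum (Phi_term a X idfun) Z & op_le Z idfun
             & forall p, P p -> forall h, ncpoly_eval p X h = 0]].

Definition Phi_seq (a : word n -> R) X (h : H) : nat -> R[i]^o :=
  fun k => inner (iter k (Phi a X) idfun h) h.

Definition class_C0 (a : word n -> R) X : Prop :=
  forall h, Phi_seq a X h @ \oo --> (0 : R[i]^o).

Definition class_C1 (a : word n -> R) X : Prop :=
  forall h, h != 0 ->
    exists2 l : R[i]^o, Phi_seq a X h @ \oo --> l & l != 0.

Definition nontrivial_joint_invariant_subspace X (M : set H) : Prop :=
  [/\ [/\ M 0, forall (c : R[i]) x y, M x -> M y -> M (c *: x + y)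
        & closed M],
      M != [set 0], M != setT
    & forall i x, M x -> M (X i x)].

End Tuples.
End Operators.

(* a is the family of coefficients of the formal series f. *)
Definition positive_regular (R : realType) (n : nat) (a : word n -> R) : Prop :=
  [/\ (limn_esup (fun k : nat =>
         ((\sum_(w : k.-tuple 'I_n) `|a w| ^+ 2) `^ ((2 * k)%:R)^-1)%:E)
       < +oo)%E,
      forall w, 0 <= a w,
      a [::] = 0
    & forall i, 0 < a [:: i]].

(* Main.v *)
Require Import Defs.
From mathcomp Require Import all_boot all_order all_algebra finmap.
From mathcomp Require Import all_classical all_reals all_analysis complex.
From mathcomp Require Import sesquilinear ring lra.
From mathcomp.analysis.showcase Require Import summability.
Local Open Scope classical_set_scope.

(** The subspace is M^perp for

      M = { h | <Phi^k(I) h, h> --> 0 },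

    where Phi = Phi_(f,T).  Three facts about the operators Phi^k(I) carry the
    argument.

    - They form a decreasing sequence of positive contractions:
      Phi(I) <= I by hypothesis, and Phi is positive and monotone
      ([Phi_iterP], [Phi_iter_anti]).  Hence <Phi^k(I) h, h> has a limit for
      every h ([Phi_seq_cvg]).  T not in C_.0 says that M is not the whole
      space.  If T is not in C_.1, some h <> 0 has no non-zero limit; as its
      limit exists, it is 0, so M <> {0}.

    - x |-> <Phi^k(I) x, x> is a positive quadratic form bounded by |x|^2,
      uniformly in k; so M is a closed linear subspace
      ([stable_subspace_closed]).

    - Every term of the series Phi(Y) is positive when Y is, and the term of
      the one-letter word g_i is a_i T_i Y T_i^*.  With Y = Phi^k(I) this gives
      a_i <Phi^k(I) T_i^* h, T_i^* h> <= <Phi^(k+1)(I) h, h>, so that M is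
      invariant under each T_i^* because a_i > 0
      ([stable_subspace_adjoint]), and M^perp is invariant under each T_i.

    The set M^perp is always a closed subspace.  It is not {0}, by the
    orthogonal projection theorem applied to the closed subspace M <> H, and
    it is not H since M <> {0}.

    The Hilbert space theory behind this is developed from the completeness
    of the space: Cauchy-Schwarz for semidefinite forms, orthogonal projection,
    the Riesz theorem, the representation of bounded sesquilinear forms by
    operators, and with it adjoints.  The same representation produces the weak
    operator sums defining Phi(Y): a series of positive operators dominated
    term by term by a convergent one converges ([wot_sum_dominated]). *)

Set Implicit Arguments.
Unset Strict Implicit.
Unset Printing Implicit Defensive.
Import Order.TTheory GRing.Theory Num.Theory.
Import numFieldNormedType.Exports.

Local Notation Re := (@complex.Re _).

(** * Sesquilinear forms *)

Section Form.
Local Open Scope ring_scope.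
Variables (C : numClosedFieldType) (V : lmodType C).
Implicit Types (s : V -> V -> C) (x y z : V).

Definition sesqui_form s :=
  (forall c x y z, s (c *: x + y) z = c * s x z + s y z) /\
  (forall c x y z, s z (c *: x + y) = c^* * s z x + s z y).

Definition pos_form s := sesqui_form s /\ forall x, 0 <= s x x.

Lemma sesqui_form0l s z : sesqui_form s -> s 0 z = 0.
Proof.
by move=> [sl _]; have := sl (-1) 0 0 z; rewrite scaler0 addr0 mulN1r addNr.
Qed.

Lemma sesqui_form0r s z : sesqui_form s -> s z 0 = 0.
Proof.
move=> [_ sr]; have := sr (-1) 0 0 z.
by rewrite scaler0 addr0 conjCN1 mulN1r addNr.
Qed.

Lemma sesqui_formZl s c x z : sesqui_form s -> s (c *: x) z = c * s x z.
Proof.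
by move=> ss; have := ss.1 c x 0 z; rewrite addr0 sesqui_form0l ?addr0.
Qed.

Lemma sesqui_formZr s c x z : sesqui_form s -> s z (c *: x) = c^* * s z x.
Proof.
by move=> ss; have := ss.2 c x 0 z; rewrite addr0 sesqui_form0r ?addr0.
Qed.

Lemma sesqui_form_square s c x y : sesqui_form s ->
  s (c *: y + x) (c *: y + x) =
  s x x + c^* * s x y + c * s y x + c * c^* * s y y.
Proof. by move=> ss; rewrite ss.1 !ss.2; ring. Qed.

Lemma sesqui_form_parallelogram s x y : sesqui_form s ->
  s (x + y) (x + y) + s (x - y) (x - y) = 2 * (s x x + s y y).
Proof.
move=> ss; have := sesqui_form_square 1 x y ss.
have := sesqui_form_square (-1) x y ss.
rewrite scaleN1r scale1r conjCN1 conjC1 ![_ + x]addrC => -> ->; ring.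
Qed.

(** Polarization reduces the convergence of a net of forms to the convergence
    of its values on the diagonal. *)
Lemma sesqui_form_polarization s x y : sesqui_form s ->
  s x y = 4^-1 * (s (x + y) (x + y) - s (x - y) (x - y) +
    'i * (s (x + 'i *: y) (x + 'i *: y) - s (x - 'i *: y) (x - 'i *: y))).
Proof.
move=> ss; have := sesqui_form_square 1 x y ss.
have := sesqui_form_square (-1) x y ss.
have := sesqui_form_square 'i x y ss.
have := sesqui_form_square (- 'i) x y ss.
rewrite scale1r !scaleNr scale1r !(rmorphN, conjC1, conjCi) /=.
rewrite !(conjC1, conjCi) opprK ![_ + x]addrC.
move=> -> -> -> ->.
move: (s x y) (s y x) (s x x) (s y y) => a b p q.
have sqi := sqrCi C.
have -> : forall u : C, 4^-1 * u = u / 4 by move=> u; rewrite mulrC.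
apply: (canRL (mulfK _)); first by rewrite pnatr_eq0.
ring: sqi.
Qed.

(** Hermitian symmetry is automatic over a closed field: the values at
    [y + x] and at ['i *: y + x] are real, which determines the real and
    imaginary parts of [s y x]. *)
Lemma pos_form_sym s x y : pos_form s -> s y x = (s x y)^*.
Proof.
move=> [ss s0].
have s0R z : (s z z)^* = s z z by apply/conj_Creal/ger0_real.
have h1 := s0R (1 *: y + x); rewrite (sesqui_form_square _ _ _ ss) in h1.
have h2 := s0R ('i *: y + x); rewrite (sesqui_form_square _ _ _ ss) in h2.
rewrite !(rmorphD, rmorphM) /= !(conjCK, conjC1, s0R, conjCi) in h1 h2.
move: h1 h2; move: (s x y) (s y x) (s x x) (s y y) => a b p q.
move: (a^*) (b^*) => a' b' /eqP + /eqP.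
rewrite -!(subr_eq0 (p + _ + _ + _)) => /eqP h1 /eqP h2.
have e1 : a' + b' - (a + b) = 0 by rewrite -h1; ring.
have /eqP : 'i * (a' - b' - (b - a)) = 0 by rewrite -h2; ring.
rewrite mulf_eq0 (negPf (neq0Ci _)) /= => /eqP e2.
have : 2 * (b - a') = - ((a' + b' - (a + b)) + (a' - b' - (b - a))) by ring.
by rewrite e1 e2 addr0 oppr0 => /eqP; rewrite mulf_eq0 pnatr_eq0 /= subr_eq0 => /eqP.
Qed.

(** Cauchy-Schwarz for forms that may be degenerate, as limits of positive
    forms are. *)
Lemma pos_form_CS s x y : pos_form s -> `|s x y| ^+ 2 <= s x x * s y y.
Proof.
move=> ps; have [ss s0] := ps.
rewrite normCK; set p := _ * _.
have p0 : 0 <= p by rewrite /p mul_conjC_ge0.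
(* Positivity at x - t (s x y) y for a free real t: the usual choice
   t = 1 / s y y is not available when s y y = 0. *)
have key (t : C) : t \is Num.real ->
    0 <= s x x - 2 * t * p + t ^+ 2 * p * s y y.
  move=> /conj_Creal tR; have := s0 ((- t * s x y) *: y + x).
  rewrite (sesqui_form_square _ _ _ ss) (pos_form_sym x y ps).
  rewrite rmorphM rmorphN /= tR; congr (0 <= _); rewrite /p; ring.
have [yy0|yy1] := eqVneq (s y y) 0.
  rewrite yy0 mulr0; have [-> //|p1] := eqVneq p 0.
  have t0 : 0 <= (s x x + 1) / p by rewrite divr_ge0 ?addr_ge0 ?ler01.
  have := key _ (ger0_real t0).
  rewrite yy0 mulr0 addr0 -mulrA divfK // => h.
  have : 0 <= - (s x x + 2).
    by move: h; congr (0 <= _); ring.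
  rewrite oppr_ge0 => /(le_trans (ler_wpDl (s0 x) (lexx _))).
  by rewrite lern0.
have yy2 : 0 < s y y by rewrite lt_def yy1 s0.
have t0 : 0 <= (s y y)^-1 by rewrite invr_ge0.
have := key _ (ger0_real t0).
have -> : s x x - 2 * (s y y)^-1 * p + (s y y)^-1 ^+ 2 * p * s y y
    = (s x x * s y y - p) / s y y by field.
by rewrite pmulr_lge0 ?invr_gt0 // subr_ge0.
Qed.

End Form.

(** * Order on the complex numbers *)

Section ComplexOrder.
Local Open Scope complex_scope.
Local Open Scope ring_scope.
Variable R : realType.
Local Notation C := R[i].

Lemma ge0_complexE (z : C) : 0 <= z -> z = (Re z)%:C.
Proof. by move=> /ger0_real /RRe_real. Qed.

(** The order on R[i] is only partial, but the non-negative elements are the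
    non-negative reals, where infima exist. *)
Lemma complex_inf (A : set C) : A !=set0 -> (forall z, A z -> 0 <= z) ->
  exists2 d : C, forall z, A z -> d <= z &
    forall e : C, 0 < e -> exists2 z, A z & z < d + e.
Proof.
move=> A0 Apos; pose B := Re @` A.
have Bi : has_inf B.
  split; first exact: image_nonempty.
  by exists 0 => _ [z Az <-]; have := Apos _ Az; rewrite lecE => /andP[].
exists (inf B)%:C => [z Az|e e0].
  rewrite (ge0_complexE (Apos _ Az)) lecR.
  by apply: (ge_inf Bi.2); exists z.
have eE := ge0_complexE (ltW e0).
have e1 : 0 < Re e by move: e0; rewrite eE ltcR.
have [_ [z Az <-] zlt] := inf_adherent e1 Bi.
by exists z => //; rewrite (ge0_complexE (Apos _ Az)) eE -rmorphD ltcR.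
Qed.

Lemma small_eq0 (a b : C) : 0 <= b ->
  (forall e, 0 < e -> `|a| <= e * b) -> a = 0.
Proof.
move=> b0 small; apply/eqP; apply: contraT => a0.
have b1 : 0 < b + 1 by rewrite ltr_wpDl.
have a1 : 0 < `|a| by rewrite normr_gt0.
have := small (`|a| / (b + 1)) (divr_gt0 a1 b1).
by rewrite -mulrA ler_pMr // ler_pdivlMl // mulr1 gerDl ler10.
Qed.

End ComplexOrder.

(** * Inner products and orthogonal projection *)

Section Hilbert.
Local Open Scope complex_scope.
Local Open Scope ring_scope.
Variables (R : realType) (H : hilbertType R).
Local Notation C := R[i].
Implicit Types (x y z : H) (M : set H).

Lemma inner_pos_form : pos_form (@inner R H : H -> H -> C).
Proof.
split; first by split=> c x y z; [exact: linearPl | exact: linearPr].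
by move=> x; rewrite -inner_norm exprn_ge0.
Qed.

Let inner_sesqui : sesqui_form (@inner R H : H -> H -> C) := inner_pos_form.1.

Lemma innerPl c x y z : inner (c *: x + y) z = c * inner x z + inner y z.
Proof. exact: inner_sesqui.1. Qed.

Lemma innerPr c x y z : inner z (c *: x + y) = c^* * inner z x + inner z y.
Proof. exact: inner_sesqui.2. Qed.

Lemma innerBl x y z : inner (x - y) z = inner x z - inner y z.
Proof. by rewrite addrC -scaleN1r innerPl mulN1r addrC. Qed.

Lemma innerC x y : inner y x = (inner x y)^*.
Proof. exact: pos_form_sym inner_pos_form. Qed.

Lemma inner_ge0 x : 0 <= inner x x.
Proof. exact: inner_pos_form.2. Qed.

Lemma inner_eq0 x : inner x x = 0 -> x = 0.
Proof. by move/eqP; rewrite -inner_norm expf_eq0 /= normr_eq0 => /eqP. Qed.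

Lemma inner_ext x y : (forall z, inner x z = inner y z) -> x = y.
Proof.
by move=> xy; apply/eqP; rewrite -subr_eq0; apply/eqP/inner_eq0;
  rewrite innerBl xy subrr.
Qed.

Lemma inner_CS x y : `|inner x y| <= `|x| * `|y|.
Proof.
rewrite -ler_sqr ?nnegrE ?mulr_ge0 // exprMn !inner_norm.
exact: pos_form_CS inner_pos_form.
Qed.

Lemma closure_norm M x : closure M x ->
  forall e : C, 0 < e -> exists2 y, M y & `|x - y| < e.
Proof.
move=> Mx e e0; have [y []] := Mx _ (nbhsx_ballx x e e0).
by rewrite -ball_normE; exists y.
Qed.

End Hilbert.

Section Projection.
Local Open Scope complex_scope.
Local Open Scope ring_scope.
Variables (R : realType) (H : hilbertType R).
Local Notation C := R[i].
Implicit Types (x y z : H) (M : set H).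

Definition closed_subspace M :=
  [/\ M 0, forall (c : C) x y, M x -> M y -> M (c *: x + y) & closed M].

Lemma closed_subspaceB M x y : closed_subspace M -> M x -> M y -> M (x - y).
Proof. by move=> [_ Ml _] Mx My; rewrite addrC -scaleN1r; apply: Ml. Qed.

(** First-order optimality, with an error: moving [m] by the optimal multiple
    of [v] decreases the squared distance to [x] by
    |<x - m, v>|^2 / |v|^2, while no more than e^2 can be gained. *)
Lemma almost_minimal_orthogonal M (d : C) x m v (e : C) :
  closed_subspace M -> (forall m, M m -> d <= `|x - m| ^+ 2) ->
  M m -> 0 < e -> `|x - m| ^+ 2 < d + e ^+ 2 -> M v ->
  `|inner (x - m) v| <= e * `|v|.
Proof.
move=> Msub dmin Mm e0 mlt Mv.
have [-> |v0] := eqVneq v 0.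
  by rewrite (sesqui_form0r _ (@inner_pos_form R H).1) !normr0 mulr0.
have n0 : 0 < inner v v :> C by rewrite -inner_norm exprn_gt0 ?normr_gt0.
have nR : (inner v v)^* = inner v v :> C by apply/conj_Creal/ger0_real/ltW.
pose c : C := inner (x - m) v / inner v v.
have Mc : M (c *: v + m) by case: Msub => _ Ml _; apply: Ml.
rewrite -ler_sqr ?nnegrE ?mulr_ge0 ?(ltW e0) // exprMn (inner_norm v) normCK.
have := dmin _ Mc.
have -> : x - (c *: v + m) = - c *: v + (x - m).
  by rewrite opprD scaleNr addrCA.
rewrite inner_norm (sesqui_form_square _ _ _ (@inner_pos_form R H).1).
have cE : c^* = (inner (x - m) v)^* / inner v v.
  by rewrite /c rmorphM /= fmorphV /= nR.
rewrite -(inner_norm (x - m)) (innerC (x - m) v) rmorphN /= cE /c.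
move: (inner (x - m) v) (inner v v) n0 => a n n0.
have -> : `|x - m| ^+ 2 + - (a^* / n) * a + - (a / n) * a^* +
    - (a / n) * - (a^* / n) * n = `|x - m| ^+ 2 - a * a^* / n.
  by field; rewrite gt_eqF.
rewrite lerBrDr => /le_lt_trans/(_ mlt).
by rewrite ltrD2l ltr_pdivrMr // => /ltW.
Qed.

(** The almost minimal points [S e] generate a Cauchy filter; its limit is the
    projection. *)
Theorem orthogonal_projection M x : closed_subspace M ->
  exists2 y, M y & forall v, M v -> inner (x - y) v = 0.
Proof.
move=> Msub; have [M0 Ml Mcl] := Msub.
have [||d dmin dlim] := @complex_inf R [set `|x - m| ^+ 2 | m in M].
- by exists (`|x - 0| ^+ 2), 0.
- by move=> _ [m _ <-]; rewrite exprn_ge0.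
have {}dmin m : M m -> d <= `|x - m| ^+ 2 by move=> Mm; apply: dmin; exists m.
pose S (e : R) := [set m | M m /\ `|x - m| ^+ 2 < d + e%:C ^+ 2].
pose F := filter_from [set e : R | 0 < e] S.
have S_orth (e : R) m v : 0 < e -> S e m -> M v ->
    `|inner (x - m) v| <= e%:C * `|v|.
  move=> e0 [Mm mlt] Mv.
  by apply: almost_minimal_orthogonal dmin Mm _ mlt Mv; rewrite ?ltcR.
(* Both x - m and x - m' are almost orthogonal to m - m', hence so is
   their difference m - m' itself. *)
have S_diam (e : R) m m' : 0 < e -> S e m -> S e m' -> `|m - m'| <= 2 * e%:C.
  move=> e0 Sm Sm'; have [->|v0] := eqVneq (m - m') 0.
    by rewrite normr0 mulr_ge0 // ler0c ltW.
  have Mv : M (m - m') by apply: closed_subspaceB Sm.1 Sm'.1.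
  rewrite -(ler_pM2r (_ : 0 < `|m - m'|)) ?normr_gt0 // -expr2.
  rewrite inner_norm -[leLHS]ger0_norm ?inner_ge0 //.
  have {1}-> : m - m' = (x - m') - (x - m) by rewrite opprB [RHS]addrC subrKA.
  rewrite innerBl (le_trans (ler_normB _ _)) // -mulrA mulr_natl mulr2n.
  by rewrite lerD // S_orth.
have FF : ProperFilter F.
  apply: filter_from_proper => [|e e0]; last first.
    have e1 : 0 < e%:C ^+ 2 :> C by rewrite exprn_gt0 // ltcR.
    by have [_ [m Mm <-] mlt] := dlim _ e1; exists m.
  apply: filter_from_filter => [|e1 e2 e10 e20]; first by exists 1; rewrite /= ltr01.
  exists (Num.min e1 e2); first by rewrite /= lt_min e10.
  have min0 : 0 <= Num.min e1 e2 by rewrite le_min !ltW.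
  move=> m [Mm mlt]; split; split=> //; apply: (lt_le_trans mlt); rewrite lerD2l;
    by rewrite -!rmorphXn lecR lerXn2r ?nnegrE ?(ltW e10) ?(ltW e20) //
       ge_min lexx ?orbT.
have FS (e : R) : 0 < e -> F (S e) by move=> e0; exists e.
have Fcauchy : cauchy_ex F.
  move=> e e0.
  have eE := ge0_complexE (ltW e0); rewrite eE ltcR in e0.
  have e1 : 0 < Re e / 3 by rewrite divr_gt0.
  have [m Sm] := filter_ex (FS _ e1).
  exists m, (Re e / 3) => // m' Sm'; rewrite -ball_normE /=.
  apply: (le_lt_trans (S_diam _ _ _ e1 Sm Sm')); rewrite [ltRHS]eE.
  by rewrite -(rmorph_nat (real_complex R)) -rmorphM ltcR; lra.
have Fcvg : cvg F := cauchy_cvg _ (cauchy_exP F Fcauchy).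
have near_lim (e : R) (B : set H) : 0 < e -> nbhs (lim F) B -> exists m, S e m /\ B m.
  move=> e0 /Fcvg FB.
  by have [m [Sm Bm]] := filter_ex (filterI (FS e e0) FB); exists m.
exists (lim F).
  apply: Mcl => B /(near_lim _ _ ltr01)[m [[Mm _] Bm]]; by exists m.
move=> v Mv; apply: (@small_eq0 _ _ (2 * `|v|)); first by rewrite mulr_ge0.
move=> e e0; have eE := ge0_complexE (ltW e0).
have e1 : 0 < Re e by rewrite -ltcR -eE.
have [m [Sm]] := near_lim _ _ e1 (nbhsx_ballx _ _ e0).
rewrite -ball_normE /= => mlt.
have -> : x - lim F = (x - m) - (lim F - m) by rewrite opprB subrKA.
rewrite innerBl (le_trans (ler_normB _ _)) // mulrCA mulr_natl mulr2n lerD //.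
  by rewrite [X in X * _]eE; apply: S_orth.
by rewrite (le_trans (inner_CS _ _)) // ler_wpM2r // ltW.
Qed.

Definition orthocomplement M := [set x | forall m, M m -> inner x m = 0 :> C].

Lemma orthocomplement_closed_subspace M : closed_subspace (orthocomplement M).
Proof.
split=> [m _|c x y Mx My m Mm|x /closure_norm clx m Mm].
- exact: sesqui_form0l (inner_pos_form H).1.
- by rewrite innerPl Mx // My // mulr0 addr0.
- apply: (@small_eq0 _ _ `|m|) => // e /clx[y My xy].
  rewrite -[inner x m]subr0 -(My m Mm) -innerBl.
  by rewrite (le_trans (inner_CS _ _)) // ler_wpM2r // ltW.
Qed.

Lemma orthocomplement_neq0 M : closed_subspace M -> M != setT ->
  orthocomplement M != [set 0].
Proof.
move=> Msub /eqP MT; apply/eqP => M0; apply: MT.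
apply/seteqP; split=> // x _.
have [y My yorth] := orthogonal_projection x Msub.
have /eqP : [set 0] (x - y) by rewrite -M0.
by rewrite subr_eq0 => /eqP ->.
Qed.

Lemma orthocomplement_neqT M x : M x -> x != 0 -> orthocomplement M != setT.
Proof.
move=> Mx /eqP x0; apply/eqP => MT; apply: x0; apply: inner_eq0.
have Ox : orthocomplement M x by rewrite MT.
exact: Ox.
Qed.

End Projection.

(** * Riesz representation and adjoints *)

Section Riesz.
Local Open Scope complex_scope.
Local Open Scope ring_scope.
Variables (R : realType) (H : hilbertType R).
Local Notation C := R[i].
Implicit Types (x y z h k : H) (A Z : H -> H).

(** If [f] is not zero, its kernel has a non-zero normal vector [w], and [f] is
    the inner product with a multiple of [w]. *)
Theorem riesz_representation (f : H -> C) (M : C) :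
  (forall c x y, f (c *: x + y) = c * f x + f y) ->
  0 <= M -> (forall x, `|f x| <= M * `|x|) ->
  exists z, forall x, f x = inner x z.
Proof.
move=> flin M0 fM.
have f0 : f 0 = 0.
  by apply/eqP; rewrite -normr_le0; have := fM 0; rewrite normr0 mulr0.
have fB x y : f (x - y) = f x - f y.
  by rewrite addrC -scaleN1r flin mulN1r addrC.
have [fz|] := pselect (forall x, f x = 0).
  by exists 0 => x; rewrite fz (sesqui_form0r _ (inner_pos_form H).1).
move=> /existsNP[x0 fx0].
pose K : set H := [set x | f x = 0].
have Ksub : closed_subspace K.
  split=> [|c x y Kx Ky|x /closure_norm Kx]; first exact: f0.
    by rewrite /K /= flin Kx Ky mulr0 addr0.
  apply: (small_eq0 M0) => e e0; have [y Ky xy] := Kx e e0.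
  rewrite -[f x]subr0 -Ky -fB (le_trans (fM _)) // mulrC.
  by rewrite ler_wpM2r // ltW.
have [y Ky yorth] := orthogonal_projection x0 Ksub.
pose w := x0 - y.
have fw : f w != 0 by rewrite /w fB Ky subr0; apply/eqP.
have w0 : inner w w != 0 :> C.
  by apply: contra_neq fw => /inner_eq0 ->.
exists ((f w)^* / inner w w *: w) => x.
rewrite (sesqui_formZr _ _ _ (inner_pos_form H).1) rmorphM /= conjCK fmorphV.
rewrite /= -(innerC w w).
have : inner (x - (f x / f w) *: w) w = 0.
  rewrite innerC yorth ?conjC0 //= /K /= fB.
  have := flin (f x / f w) w 0; rewrite !(addr0, f0) => ->.
  by rewrite divfK // subrr.
rewrite innerBl (sesqui_formZl _ _ _ (inner_pos_form H).1) => /eqP.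
by rewrite subr_eq0 => /eqP ->; field; rewrite fw.
Qed.

(** The Riesz theorem applies to the conjugate of [B h] for each [h], as [B] is
    conjugate linear in its second argument; uniqueness of the representing
    vectors makes them depend linearly on [h]. *)
Theorem bounded_form_representation (B : H -> H -> C) (M : C) :
  sesqui_form B -> 0 <= M -> (forall h k, `|B h k| <= M * (`|h| * `|k|)) ->
  exists2 Z, bounded_op Z & forall h k, inner (Z h) k = B h k.
Proof.
move=> sB M0 BM.
have /choice[Z ZE] h : exists z, forall k, (B h k)^* = inner k z.
  apply: (@riesz_representation _ (M * `|h|)) => [c x y||k].
  - by rewrite sB.2 rmorphD rmorphM /= conjCK.
  - by rewrite mulr_ge0.
  - by rewrite norm_conjC -mulrA BM.
have {}ZE h k : inner (Z h) k = B h k by rewrite innerC -ZE conjCK.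
exists Z => //; split.
  by move=> c x y; apply: inner_ext => z; rewrite innerPl !ZE sB.1.
exists (Re M) => h; rewrite -ge0_complexE //.
have [->|Zh0] := eqVneq (Z h) 0; first by rewrite normr0 mulr_ge0.
rewrite -(ler_pM2r (_ : 0 < `|Z h|)) ?normr_gt0 // -expr2 -mulrA.
by rewrite inner_norm -[leLHS]ger0_norm ?inner_ge0 // ZE.
Qed.

(** On the trivial space a bound may be negative; a non-negative one can be
    multiplied with inequalities. *)
Lemma bounded_opP A : bounded_op A ->
  exists2 M : C, 0 <= M & forall h, `|A h| <= M * `|h|.
Proof.
move=> [_ [M AM]]; exists `|M|%:C; first by rewrite ler0c.
by move=> h; rewrite (le_trans (AM h)) // ler_wpM2r // lecR ler_norm.
Qed.

(** Existence: the bounded form [inner h (A k)] is represented by an operator. *)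
Lemma adjointP A : bounded_op A ->
  bounded_op (adjoint A) /\
  forall h k, inner (A h) k = inner h (adjoint A k).
Proof.
move=> bA; have [M M0 AM] := bounded_opP bA.
apply: (@xgetPex _ 0 [set B : H -> H | bounded_op B /\
  forall h k, inner (A h) k = inner h (B k)]).
have [|h k|Z bZ ZE] := @bounded_form_representation (fun h k => inner h (A k)) _ _ M0.
- by split=> c x y z; [rewrite innerPl | rewrite bA.1 innerPr].
- rewrite (le_trans (inner_CS _ _)) // mulrCA ler_wpM2l //; exact: AM.
- by exists Z; split=> // h k; rewrite innerC -ZE -innerC.
Qed.

End Riesz.

(** * Weak operator sums of positive operators *)

Section ComplexLimits.
Local Open Scope complex_scope.
Local Open Scope ring_scope.
Variable R : realType.
Local Notation C := R[i].

Lemma cvg_complex_unique (T : Type) (F : set_system T) {FF : ProperFilter F}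
    (f : T -> C^o) (l m : C^o) : f @ F --> l -> f @ F --> m -> l = m.
Proof. exact: (@cvg_unique _ (@norm_hausdorff _ C^o)). Qed.

Lemma eq_cvg_complex (T : Type) (F : set_system T) (f g : T -> C^o) (l : C^o) :
  f =1 g -> g @ F --> l -> f @ F --> l.
Proof. by move=> /funext ->. Qed.

Lemma cvg_complex_ge0 (T : Type) (F : set_system T) {FF : ProperFilter F}
    (f : T -> C^o) (l : C^o) :
  f @ F --> l -> (\forall x \near F, 0 <= (f x : C)) -> 0 <= (l : C).
Proof.
move=> fl f0; have fl' : f @ F --> (`|l : C| : C^o).
  apply: cvg_trans (cvg_norm fl); apply: near_eq_cvg.
  by apply: filterS f0 => x x0; rewrite ger0_norm.
by rewrite -[l : C](cvg_complex_unique fl' fl).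
Qed.

(** Stated for a filter so as to serve both the sequences Phi^k(I) and the nets
    of finite partial sums. *)
Lemma decreasing_net_cvg (T : Type) (F : set_system T) {FF : ProperFilter F}
    (f : T -> C) :
  (forall x, 0 <= f x) ->
  (forall x0, \forall x \near F, f x <= f x0) ->
  exists l : C^o, (f : T -> C^o) @ F --> l.
Proof.
move=> f0 fdecr; have [x _] := filter_ex (@filterT _ F _).
have [||d dle dlim] := @complex_inf R (range f).
- by exists (f x), x.
- by move=> _ [y _ <-].
exists d; apply/cvgrPdist_lt => e e0.
have [_ [y _ <-] ylt] := dlim e e0.
apply: filterS (fdecr y) => z zy.
have dz : d <= f z by apply: dle; exists z.
by rewrite distrC ger0_norm ?subr_ge0 // ltrBlDl (le_lt_trans zy).
Qed.

Lemma squeeze_complex0 (f g : nat -> C^o) :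
  (forall k, 0 <= f k :> C) -> (forall k, f k <= g k :> C) ->
  g @ \oo --> (0 : C^o) -> f @ \oo --> (0 : C^o).
Proof.
move=> f0 fg g0; apply/cvgr0Pnorm_lt => e e0.
move/cvgr0Pnorm_lt/(_ e e0): g0; apply: filterS => k.
apply: le_lt_trans; rewrite ger0_norm // (le_trans (fg k)) //.
by rewrite ger0_norm // (le_trans (f0 k)) // fg.
Qed.

End ComplexLimits.

Section WeakSums.
Local Open Scope complex_scope.
Local Open Scope ring_scope.
Variables (R : realType) (H : hilbertType R) (n : nat).
Local Notation C := R[i].
Implicit Types (h k x y z : H) (S : word n -> H -> H) (Z : H -> H).
Implicit Types (W : {fset word n}).

Local Instance totally_proper (I : choiceType) : ProperFilter (@totally I) :=
  totally_filter.

Definition partial_form S W h k : C :=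
  \sum_(w <- W | (1 <= size w)%N) inner (S w h) k.

Lemma wot_sum_cvg S Z : wot_sum S Z -> forall h k,
  (fun W => partial_form S W h k : C^o) @ totally --> (inner (Z h) k : C^o).
Proof. by move=> [_]; apply. Qed.
Arguments wot_sum_cvg {S Z} _ h k.

Lemma totally_above (I : choiceType) (A : {fset I}) :
  \forall B \near totally, (A `<=` B)%fset.
Proof. by exists A. Qed.

Lemma partial_form_mono S W W' h :
  (forall w, (1 <= size w)%N -> 0 <= inner (S w h) h :> C) ->
  (W `<=` W')%fset -> partial_form S W h h <= partial_form S W' h h.
Proof.
move=> S0 WW'; rewrite /partial_form.
rewrite [leRHS](big_fsetIDcond _ (mem W)) /=.
have -> : [fset x in W' | x \in W]%fset = W.
  by apply/fsetP => w; rewrite !inE andbC; apply/andb_idr/(fsubsetP WW').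
by rewrite lerDl sumr_ge0.
Qed.

Lemma partial_form_sesqui S W :
  (forall w, (1 <= size w)%N -> linear (S w)) ->
  sesqui_form (partial_form S W).
Proof.
move=> Slin; split=> c x y z; rewrite /partial_form mulr_sumr -big_split /=;
  apply: eq_bigr => w w1; first by rewrite Slin // innerPl.
exact: innerPr.
Qed.

Lemma wot_sum_ge_partial S Z : wot_sum S Z -> forall W h,
  (forall w, (1 <= size w)%N -> 0 <= inner (S w h) h :> C) ->
  partial_form S W h h <= inner (Z h) h.
Proof.
move=> SZ W h S0; rewrite -subr_ge0.
have SB : (fun W' => partial_form S W' h h - partial_form S W h h : C^o) @ totally
    --> (inner (Z h) h - partial_form S W h h : C^o).
  by apply: cvgB; [exact: wot_sum_cvg | exact: cvg_cst].
apply: (cvg_complex_ge0 SB).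
apply: filterS (totally_above W) => W' WW'.
by rewrite subr_ge0 partial_form_mono.
Qed.

Lemma wot_sum_le S S' Z Z' : wot_sum S Z -> wot_sum S' Z' ->
  (forall w, (1 <= size w)%N -> op_le (S w) (S' w)) -> op_le Z Z'.
Proof.
move=> SZ SZ' SS' h; rewrite -subr_ge0.
have SB : (fun W => partial_form S' W h h - partial_form S W h h : C^o) @ totally
    --> (inner (Z' h) h - inner (Z h) h : C^o).
  by apply: cvgB; exact: wot_sum_cvg.
apply: (cvg_complex_ge0 SB); apply: nearW => W.
by rewrite subr_ge0 ler_sum // => w w1; apply: SS'.
Qed.

Definition pos_op Z := forall h, 0 <= inner (Z h) h :> C.

Lemma wot_sum_pos S Z : wot_sum S Z ->
  (forall w, (1 <= size w)%N -> pos_op (S w)) -> pos_op Z.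
Proof.
move=> SZ S0 h; have := wot_sum_ge_partial SZ fset0 (fun w w1 => S0 w w1 h).
by rewrite /partial_form big_seq_fsetE big1 // => -[].
Qed.

(** On the diagonal the partial sums increase and are bounded by [Z'], so they
    converge; by polarization they converge everywhere.  The limit is a
    positive form, bounded by Cauchy-Schwarz and its bound on the diagonal,
    hence it is given by an operator. *)
Lemma wot_sum_dominated S S' Z' : wot_sum S' Z' ->
  (forall w, (1 <= size w)%N ->
    [/\ linear (S w), pos_op (S w) & op_le (S w) (S' w)]) ->
  exists Z, wot_sum S Z.
Proof.
move=> SZ' SP.
have S0 w h : (1 <= size w)%N -> 0 <= inner (S w h) h :> C.
  by move=> w1; have [] := SP w w1.
have SS' w h : (1 <= size w)%N -> inner (S w h) h <= inner (S' w h) h :> C.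
  by move=> w1; have [] := SP w w1.
have FW W := partial_form_sesqui W (fun w w1 => let: And3 l _ _ := SP w w1 in l).
have partial_ub W h : partial_form S W h h <= inner (Z' h) h.
  apply: le_trans (wot_sum_ge_partial SZ' W _); last first.
    by move=> w w1; apply: le_trans (S0 w h w1) (SS' w h w1).
  by apply: ler_sum => w w1; apply: SS'.
have diag_cvg h : exists l : C^o,
    (fun W => partial_form S W h h : C^o) @ totally --> l.
  have [||l fl] := @decreasing_net_cvg R _ totally _
    (fun W => inner (Z' h) h - partial_form S W h h).
  - by move=> W; rewrite subr_ge0.
  - move=> W; apply: filterS (totally_above W) => W' WW'.
    by rewrite lerD2l lerN2; apply: partial_form_mono => // w w1; apply: S0.
  - exists (inner (Z' h) h - l).
    apply: (cvg_trans _ (cvgB (cvg_cst (inner (Z' h) h : C^o)) fl)).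
    apply: near_eq_cvg; apply: nearW => W.
    by rewrite !fctE opprB addrC subrK.
have polar_cvg h k : exists l : C^o,
  (fun W => partial_form S W h k : C^o) @ totally --> l.
  have [l1 f1] := diag_cvg (h + k); have [l2 f2] := diag_cvg (h - k).
  have [l3 f3] := diag_cvg (h + 'i *: k); have [l4 f4] := diag_cvg (h - 'i *: k).
  eexists; apply: eq_cvg_complex.
    by move=> W; apply: (sesqui_form_polarization h k (FW W)).
  apply: cvgMr; apply: cvgD; first exact: (cvgB f1 f2).
  by apply: cvgMr; exact: (cvgB f3 f4).
have /choice[B0 B0P] (hk : H * H) := polar_cvg hk.1 hk.2.
pose B h k : C := B0 (h, k).
have BP h k : (fun W => partial_form S W h k : C^o) @ totally --> (B h k : C^o)
  := B0P (h, k).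
have Bpos : pos_form B.
  split; [split=> c x y z|move=> x].
  - apply: (cvg_complex_unique (BP _ _)).
    apply: eq_cvg_complex; first by move=> W; apply: ((FW W).1 c x y z).
    by apply: cvgD; first exact: cvgMr.
  - apply: (cvg_complex_unique (BP _ _)).
    apply: eq_cvg_complex; first by move=> W; apply: ((FW W).2 c x y z).
    by apply: cvgD; first exact: cvgMr.
  - apply: (cvg_complex_ge0 (BP x x)); apply: nearW => W.
    by apply: sumr_ge0 => w w1; apply: S0.
have [M M0 Z'M] := bounded_opP SZ'.1.
have BM h : B h h <= M * `|h| ^+ 2.
  have B_le : B h h <= inner (Z' h) h.
    rewrite -subr_ge0; apply: (cvg_complex_ge0 (cvgB (cvg_cst _) (BP h h))).
    by apply: nearW => W; rewrite subr_ge0.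
  rewrite (le_trans B_le) // (le_trans (real_ler_norm _)) //.
    by rewrite ger0_real // (le_trans _ B_le) // Bpos.2.
  by rewrite (le_trans (inner_CS _ _)) // expr2 mulrA ler_wpM2r.
have [|Z bZ ZE] := bounded_form_representation Bpos.1 M0.
  move=> h k; rewrite -ler_sqr ?nnegrE ?mulr_ge0 //.
  rewrite (le_trans (pos_form_CS _ _ Bpos)) //.
  have -> : (M * (`|h| * `|k|)) ^+ 2 = (M * `|h| ^+ 2) * (M * `|k| ^+ 2) by ring.
  by rewrite ler_pM // Bpos.2.
by exists Z; split; [exact: bZ | move=> h k; rewrite ZE; exact: BP].
Qed.

End WeakSums.

(** * The iterates of Phi *)

Section Phi.
Local Open Scope complex_scope.
Local Open Scope ring_scope.
Variables (R : realType) (H : hilbertType R) (n : nat).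
Local Notation C := R[i].
Variables (a : word n -> R) (X : 'I_n -> H -> H).
Hypothesis a_ge0 : forall w, 0 <= a w.
Hypothesis X_bounded : forall i, bounded_op (X i).
Implicit Types (h x y : H) (k : nat) (Y Z : H -> H) (w : word n).

Lemma word_op_bounded w : bounded_op (word_op X w).
Proof.
elim: w => [|i w [wlin [M wM]]] /=.
  by split=> //; exists 1 => h; rewrite mul1r.
have [Xlin _] := X_bounded i; have [N N0 XN] := bounded_opP (X_bounded i).
split; first by move=> c x y /=; rewrite wlin Xlin.
exists (Re N * M) => h; rewrite (le_trans (XN _)) // rmorphM /= -ge0_complexE //.
by rewrite -mulrA ler_wpM2l.
Qed.

(** Each term is the congruence of [Y] by the adjoint of a word in [X]; this is
    why it is positive and monotone in [Y]. *)
Lemma inner_Phi_term Y w x y :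
  inner (Phi_term a X Y w x) y =
  (a w)%:C * inner (Y (adjoint (word_op X w) x)) (adjoint (word_op X w) y).
Proof.
rewrite (sesqui_formZl _ _ _ (inner_pos_form H).1).
by rewrite (adjointP (word_op_bounded w)).2.
Qed.

Lemma Phi_term_linear Y w : linear Y -> linear (Phi_term a X Y w).
Proof.
move=> Ylin c x y; have bw := word_op_bounded w.
rewrite /Phi_term (adjointP bw).1.1 Ylin bw.1.
by rewrite scalerDr !scalerA mulrC.
Qed.

Lemma Phi_term_pos Y w : pos_op Y -> pos_op (Phi_term a X Y w).
Proof. by move=> Y0 h; rewrite inner_Phi_term mulr_ge0 // ler0c. Qed.

Lemma Phi_term_le Y Z w :
  op_le Y Z -> op_le (Phi_term a X Y w) (Phi_term a X Z w).
Proof. by move=> YZ h; rewrite !inner_Phi_term ler_wpM2l // ler0c. Qed.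

(** [Phi] is monotone wherever its series converges, and convergence at [Y']
    implies convergence at every positive [Y] below [Y']. *)
Lemma Phi_dominated Y Y' Z' : linear Y -> pos_op Y -> op_le Y Y' ->
  wot_sum (Phi_term a X Y') Z' ->
  [/\ wot_sum (Phi_term a X Y) (Phi a X Y), pos_op (Phi a X Y)
    & op_le (Phi a X Y) Z'].
Proof.
move=> Ylin Y0 YY' SZ'.
have SPhi : wot_sum (Phi_term a X Y) (Phi a X Y).
  apply: (@xgetPex _ _ [set Z | wot_sum (Phi_term a X Y) Z]).
  apply: wot_sum_dominated SZ' _ => w _.
  by split; [exact: Phi_term_linear|exact: Phi_term_pos|exact: Phi_term_le].
split=> //; first by apply: wot_sum_pos SPhi _ => w _; apply: Phi_term_pos.
by apply: wot_sum_le SPhi SZ' _ => w _; apply: Phi_term_le.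
Qed.

(** A sum of positive terms dominates its term of index [:: i]. *)
Lemma Phi_ge_letter Y Z i h : pos_op Y -> wot_sum (Phi_term a X Y) Z ->
  (a [:: i])%:C * inner (Y (adjoint (X i) h)) (adjoint (X i) h)
    <= inner (Z h) h.
Proof.
move=> Y0 SZ.
have := wot_sum_ge_partial SZ [fset [:: i]]%fset
  (fun w _ => Phi_term_pos w Y0 h).
by rewrite /partial_form big_mkcond big_seq_fset1 /= inner_Phi_term.
Qed.

Variable Z1 : H -> H.
Hypothesis SZ1 : wot_sum (Phi_term a X idfun) Z1.
Hypothesis Z1_le1 : op_le Z1 idfun.

Local Notation PhiI k := (iter k (Phi a X) (@idfun H)).

Lemma Phi_iterP k :
  [/\ linear (PhiI k), pos_op (PhiI k), wot_sum (Phi_term a X (PhiI k)) (PhiI k.+1)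
    & op_le (PhiI k.+1) (PhiI k)].
Proof.
elim: k => [|k [Ylin Y0 SY Yle]].
  have id0 : pos_op (@idfun H) by move=> h; apply: inner_ge0.
  have id_lin : linear (@idfun H) by move=> c x y; reflexivity.
  have id_le : op_le (@idfun H) idfun by move=> h; apply: lexx.
  have [SPhi _ Phi_le] := Phi_dominated id_lin id0 id_le SZ1.
  by split=> // h; apply: le_trans (Phi_le h) (Z1_le1 h).
have Ylin1 : linear (PhiI k.+1) := SY.1.1.
have Y1_0 : pos_op (PhiI k.+1).
  by apply: wot_sum_pos SY _ => w _; apply: Phi_term_pos.
by have [SPhi _ Phi_le] := Phi_dominated Ylin1 Y1_0 Yle SY; split.
Qed.

Lemma Phi_iter_anti k l h :
  (k <= l)%N -> inner (PhiI l h) h <= inner (PhiI k h) h :> C.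
Proof.
move=> /subnKC <-; elim: (l - k)%N => [|m IH]; first by rewrite addn0.
by rewrite addnS (le_trans _ IH) //; have [_ _ _] := Phi_iterP (k + m); apply.
Qed.

Lemma Phi_seq_ge0 h k : 0 <= Phi_seq a X h k :> C.
Proof. by have [_ Y0 _ _] := Phi_iterP k; apply: Y0. Qed.

Lemma Phi_seq_cvg h : exists l : C^o, Phi_seq a X h @ \oo --> l.
Proof.
apply: (@decreasing_net_cvg R nat \oo _ (Phi_seq a X h)).
  exact: Phi_seq_ge0.
by move=> k; exists k => // l; apply: Phi_iter_anti.
Qed.

(** For one operator X and a = 1 on the letter only, these are the vectors that
    the powers of the adjoint of X send to 0. *)
Definition stable_subspace := [set h | Phi_seq a X h @ \oo --> (0 : C^o)].

Lemma Phi_iter_form k : sesqui_form (fun x y => inner (PhiI k x) y : C).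
Proof.
have [PhiIlin _ _ _] := Phi_iterP k.
by split=> c x y z; [rewrite PhiIlin innerPl | rewrite innerPr].
Qed.

Lemma Phi_seqD x y k :
  Phi_seq a X (x + y) k <= 2 * (Phi_seq a X x k + Phi_seq a X y k) :> C.
Proof.
have [_ PhiI0 _ _] := Phi_iterP k.
have /= <- := sesqui_form_parallelogram x y (Phi_iter_form k).
by rewrite lerDl PhiI0.
Qed.

Lemma Phi_seqZ c x k : Phi_seq a X (c *: x) k = c * c^* * Phi_seq a X x k :> C.
Proof.
rewrite /Phi_seq.
have /= -> := sesqui_formZl c x (c *: x) (Phi_iter_form k).
by have /= -> := sesqui_formZr c x x (Phi_iter_form k); rewrite mulrA.
Qed.

(** Linearity comes from homogeneity and from the inequality
    q (x + y) <= 2 (q x + q y), valid for every positive quadratic form q;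
    closedness uses moreover that the forms are bounded by the squared norm
    simultaneously for all iterates. *)
Lemma stable_subspace_closed : closed_subspace stable_subspace.
Proof.
split=> [|c x y Mx My|x /closure_norm clx].
- have Z0 k : Phi_seq a X 0 k = 0 :> C.
    by rewrite -(scale0r 0) Phi_seqZ !mul0r.
  by apply: (eq_cvg_complex Z0); apply: cvg_cst.
- apply: (@squeeze_complex0 R _ (fun k =>
     2 * (c * c^* * Phi_seq a X x k + Phi_seq a X y k) : C)).
  + exact: Phi_seq_ge0.
  + by move=> k; rewrite -Phi_seqZ Phi_seqD.
  + rewrite -[X in _ --> (X : C^o)](mulr0 (2 : C)); apply: cvgMr.
    rewrite -[X in _ --> (X : C^o)](addr0 (0 : C)); apply: cvgD => //.
    by rewrite -[X in _ --> (X : C^o)](mulr0 (c * c^*)); apply: cvgMr.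
- rewrite /stable_subspace /=; have [l xl] := Phi_seq_cvg x.
  suff <- : l = 0 by [].
  have l0 : 0 <= (l : C).
    by apply: (cvg_complex_ge0 xl); apply: nearW => k; apply: Phi_seq_ge0.
  apply: (@small_eq0 R _ 2) => // e e0.
  (* The squared distance enters the bound below, hence the square root. *)
  have [|y My xy] := clx (sqrtC e); first by rewrite sqrtC_gt0.
  have xy2 : `|x - y| ^+ 2 <= e.
    by rewrite -[leRHS]sqrtCK lerXn2r ?nnegrE ?sqrtC_ge0 // ltW.
  rewrite ger0_norm // mulrC (le_trans _ (ler_wpM2l _ xy2)) //.
  rewrite -subr_ge0 -[X in X - _]addr0 -[X in _ + X - _](mulr0 2) -mulrDr.
  have lim :
      (fun k => 2 * (`|x - y| ^+ 2 + Phi_seq a X y k) - Phi_seq a X x k : C^o)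
        @ \oo
      --> (2 * (`|x - y| ^+ 2 + 0) - l : C^o).
    apply: cvgB; last exact: xl.
    by apply: cvgMr; apply: cvgD; [exact: cvg_cst | exact: My].
  apply: (cvg_complex_ge0 lim); apply: nearW => k.
  rewrite subr_ge0 -{1}(subrK y x) (le_trans (Phi_seqD _ _ _)) //.
  by rewrite ler_wpM2l // lerD2r inner_norm; apply: (Phi_iter_anti (x - y) (leq0n k)).
Qed.

(** The values at [adjoint (X i) h] are bounded by those at [h] one step later,
    divided by the coefficient of the letter [i]. *)
Lemma stable_subspace_adjoint i h : 0 < a [:: i] ->
  stable_subspace h -> stable_subspace (adjoint (X i) h).
Proof.
move=> ai Mh.
have ai' : 0 < (a [:: i])%:C :> C by rewrite ltcR.
apply: (@squeeze_complex0 R _ (fun k => (a [:: i])%:C^-1 * Phi_seq a X h k.+1)).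
- exact: Phi_seq_ge0.
- move=> k; have [_ Y0 SY _] := Phi_iterP k.
  by rewrite ler_pdivlMl //; apply: Phi_ge_letter SY.
- rewrite -[X in _ --> (X : C^o)](mulr0 (a [:: i])%:C^-1); apply: cvgMr.
  by rewrite (cvg_shiftS (Phi_seq a X h)).
Qed.

Lemma stable_complement_invariant i x : 0 < a [:: i] ->
  orthocomplement stable_subspace x ->
  orthocomplement stable_subspace (X i x).
Proof.
move=> ai Mx m Mm; rewrite (adjointP (X_bounded i)).2.
by apply/Mx/stable_subspace_adjoint.
Qed.

End Phi.

(** * The invariant subspace *)

Theorem corollary4p8 (R : realType) (n : nat) (n_gt0 : (0 < n)%N)
    (H : hilbertType R) (a : word n -> R) (P : set (ncpoly R n))
    (T : 'I_n -> H -> H) :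
  positive_regular a ->
  variety a P T ->
  ~ class_C0 a T ->
  ~ class_C1 a T ->
  exists M : set H, nontrivial_joint_invariant_subspace T M.
Proof.
move=> [_ a0 _ ai] [bT [Z SZ Z1] _] notC0 notC1.
have Mcl := stable_subspace_closed a0 bT SZ Z1.
exists (orthocomplement (stable_subspace a T)); split.
- exact: orthocomplement_closed_subspace.
- apply: orthocomplement_neq0 => //; apply/eqP => MT; apply: notC0 => h.
  by have : stable_subspace a T h by rewrite MT.
- have /existsNP[h /not_implyP[h0 hl]] := notC1.
  apply: (@orthocomplement_neqT _ _ _ h) => //.
  have [l hcvg] := Phi_seq_cvg a0 bT SZ Z1 h.
  have [l0|l0] := eqVneq l (0 : R[i]^o)%R; first by rewrite l0 in hcvg.
  by case: hl; exists l.
- move=> i x; exact: (stable_complement_invariant a0 bT SZ Z1 (ai i)).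
Qed.
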